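(* Let $X$, $Y$ be complete metric spaces and $Z\subset X$ a closed subset which has Nagata dimension zero with constant $c$. Suppose that $Y$ is $\lambda$-quasiconvex for some $\lambda\geq 1$. Then every $1$-Lipschitz map $f\colon Z\to Y$ admits an $8c\lambda$-Lipschitz extension $\bar{f}\colon X\to Y$.
   Context: A metric space $X$ has \emph{Nagata dimension zero with constant} $c$ if for all real numbers $s>0$, $X$ admits a covering $\mathcal{B}_s$ (by subsets of $X$) with $\operatorname{diam}(B)\leq cs$ for every $B\in\mathcal{B}_s$ and $d(B,B')>s$ for all distinct $B,B'\in\mathcal{B}_s$, where $d(B,B')=\inf\{d(b,b'): b\in B,\ b'\in B'\}$. A subset $Z\subset X$ is regarded as a metric space with the restricted metric. A metric space $Y$ is $\lambda$-\emph{quasiconvex}, for some $\lambda\geq 1$, if all $y_1,y_2\in Y$ can be connected via a continuous curve $\gamma\colon[a,b]\to Y$ such that $\ell(\gamma)\leq\lambda\, d(y_1,y_2)$, where $\ell(\gamma)$ denotes the length of $\gamma$. A map $f$ between metric spaces is $L$-\emph{Lipschitz} if $d(f(x),f(y))\leq L\,d(x,y)$ for all $x,y$. *)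

(* Defs.v *)
From HB Require Import structures.
From mathcomp Require Import all_boot all_order all_algebra.
From mathcomp Require Import all_classical all_reals all_analysis.

Set Implicit Arguments.
Unset Strict Implicit.
Unset Printing Implicit Defensive.

Import Order.TTheory GRing.Theory Num.Theory.
Import numFieldNormedType.Exports.

Local Open Scope classical_set_scope.
Local Open Scope ring_scope.

(* The restricted metric on a subset Z, seen as the type [set_type Z]; its
   balls are those of the pseudometric that the library already puts on Z. *)
Section restricted_metric.
Context {R : realType} {X : metricType R} (Z : set X).

Let rdist (x y : Z) : R := mdist (\val x) (\val y).

Let rdist_ge0 x y : 0 <= rdist x y.
Proof. exact: mdist_ge0. Qed.

Let rdist_positivity x y : rdist x y = 0 -> x = y.
Proof. by move=> /mdist_positivity; exact: val_inj. Qed.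

Let ballErdist (x : Z) (d : R) : ball x d = [set y | rdist x y < d].
Proof. by rewrite -initial_ballE ballEmdist. Qed.

HB.instance Definition _ := @PseudoMetric_isMetric.Build R (set_type Z)
  rdist rdist_ge0 rdist_positivity ballErdist.

End restricted_metric.

(* The library's [completeType] is pointed; this is its completeness axiom
   without that restriction. *)
Definition complete_space (T : uniformType) : Prop :=
  forall F : set_system T, ProperFilter F -> cauchy F -> exists x : T, F --> x.

Section metric_notions.
Context {R : realType}.
Implicit Types T U : metricType R.

(* Not the library's [k.-lipschitz], which needs normed modules. *)
Definition mlipschitz T U (L : R) (f : T -> U) : Prop :=
  forall x y : T, mdist (f x) (f y) <= L * mdist x y.

(* Equal to -oo on the empty set. *)
Definition diam T (B : set T) : \bar R :=
  ereal_sup [set (mdist p.1 p.2)%:E | p in B `*` B].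

(* Equal to +oo when one of the sets is empty. *)
Definition set_dist T (B B' : set T) : \bar R :=
  ereal_inf [set (mdist p.1 p.2)%:E | p in B `*` B'].

Definition nagata_dim0 T (c : R) : Prop :=
  forall s : R, 0 < s -> exists Bs : set (set T),
    [/\ \bigcup_(B in Bs) B = [set: T],
        forall B, Bs B -> (diam B <= (c * s)%:E)%E &
        forall B B', Bs B -> Bs B' -> B <> B' -> (s%:E < set_dist B B')%E].

(* Metric counterpart of the library's [variation] and [total_variation]: a
   subdivision a = t_0 < t_1 < ... < t_n = b is encoded by s = [t_1; ...; t_n]
   with [itv_partition a b s]. *)
Definition curve_length T (a b : R) (gamma : R -> T) : \bar R :=
  ereal_sup [set (\sum_(0 <= n < size s)
      mdist (gamma (nth b (a :: s) n)) (gamma (nth b (a :: s) n.+1)))%:E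
    | s in itv_partition a b].

Definition quasiconvex T (lambda : R) : Prop :=
  forall y1 y2 : T, exists (a b : R) (gamma : R -> T),
    [/\ a <= b, {within `[a, b], continuous gamma},
        gamma a = y1, gamma b = y2 &
        (curve_length a b gamma <= (lambda * mdist y1 y2)%:E)%E].

End metric_notions.

Arguments nagata_dim0 {R} T c.
Arguments quasiconvex {R} T lambda.

(* Main.v *)
(* Joining points of Z by chains with steps < 2 ^ k, for integers k, gives nested
   partitions of Z, hence an ultrametric (with values powers of 2), and by the
   Nagata condition each class has diameter at most c 2 ^ k.  The R-tree of this
   ultrametric maps to Y by sending the nodes to values of f at chosen
   representatives and the edges to quasi-geodesics; this is 4 c lambda-Lipschitz
   in the doubled height.  A point x of X is sent to the point of the tree at
   height d(x, Z) above almost nearest points of Z.  Since the tree branches only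
   at discrete heights this is well defined even if no nearest point exists, and
   it is 1-Lipschitz. *)

Require Import Defs.
From HB Require Import structures.
From mathcomp Require Import all_boot all_order all_algebra.
From mathcomp Require Import all_classical all_reals all_analysis.
From mathcomp Require Import lra.

Set Implicit Arguments.
Unset Strict Implicit.
Unset Printing Implicit Defensive.

Import Order.TTheory GRing.Theory Num.Theory.
Import numFieldNormedType.Exports.

Local Open Scope classical_set_scope.
Local Open Scope ring_scope.

(** * Curve length and parametrisation by arc length *)

Lemma curve_lengthD_ge (R : realType) (T : metricType R) (gamma : R -> T)
    (a p q : R) : p < q ->
  (curve_length a p gamma + (mdist (gamma p) (gamma q))%:E
     <= curve_length a q gamma)%E.
Proof.
move=> pq; rewrite -leeBrDr//; apply: ge_ereal_sup => _ [s [ps /eqP lasts] <-].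
rewrite leeBrDr// -EFinD; apply: ereal_sup_ubound; exists (rcons s q).
  by split; rewrite ?rcons_path ?last_rcons// ps lasts.
congr (_%:E); rewrite size_rcons big_nat_recr//=.
congr (_ + mdist (gamma _) (gamma _)).
- apply: eq_big_nat => i /andP[_ si].
  have E j : (j <= size s)%N -> nth q (a :: rcons s q) j = nth p (a :: s) j.
    move=> js; rewrite -rcons_cons nth_rcons /= ltnS js.
    by apply: set_nth_default; rewrite /= ltnS.
  rewrite E ?(ltnW si)// -[nth q (rcons s q) i]/(nth q (a :: rcons s q) i.+1).
  by rewrite E.
- by rewrite -rcons_cons nth_rcons /= ltnSn -lasts (last_nth q).
- by rewrite nth_rcons ltnn eqxx.
Qed.

Lemma curve_length_refl (R : realType) (T : metricType R) (gamma : R -> T)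
    (a : R) : curve_length a a gamma = 0%E.
Proof.
apply/eqP; rewrite eq_le; apply/andP; split; last first.
  by apply: ereal_sup_ubound; exists [::] => //=; rewrite big_nil.
apply: ge_ereal_sup => _ [[|x s] [+ /eqP lasts] <-]; first by rewrite big_nil.
move=> /= /andP[ax /(order_path_min lt_trans) /allP xs].
have : a < last x s.
  have := mem_last x s; rewrite inE => /orP[/eqP->//|/xs]; exact: lt_trans.
by rewrite -[last x s]/(last a (x :: s)) lasts ltxx.
Qed.

(* The parametrisation by arc length, as tau |-> gamma (sup {t | length of
   gamma on [a, t] <= tau}); with this choice continuity of the length function
   is not needed. *)
Lemma curve_reparametrization (R : realType) (T : metricType R) (gamma : R -> T)
    (a b L : R) : a <= b -> {within `[a, b], continuous gamma} ->
  (curve_length a b gamma <= L%:E)%E ->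
  exists sigma : R -> T, [/\ sigma 0 = gamma a, sigma L = gamma b &
    forall t t', 0 <= t -> t <= t' -> mdist (sigma t) (sigma t') <= t' - t].
Proof.
move=> ab /subspace_continuousP cts lenL.
have {}cts t : a <= t <= b -> forall e, 0 < e -> exists2 d, 0 < d &
    forall u, a <= u <= b -> `|t - u| < d -> mdist (gamma t) (gamma u) < e.
  move=> tab e e0.
  have := cts t _ _ (nbhsx_ballx (gamma t) e e0).
  rewrite /= in_itv => /(_ tab) /nbhs_ballP[d d0 dP]; exists d => // u uab ud.
  by have := dP u ud; rewrite /= in_itv ballEmdist => /(_ uab).
pose S tau := [set t | a <= t <= b /\ (curve_length a t gamma <= tau%:E)%E].
pose tm tau := sup (S tau).
have Sa tau : 0 <= tau -> S tau a.
  by move=> tau0; split; rewrite ?lexx ?ab// curve_length_refl lee_fin.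
have Sub tau : has_ubound (S tau) by exists b => t [/andP[]].
have tmab tau : 0 <= tau -> a <= tm tau <= b.
  move=> tau0; apply/andP; split; first by apply: ub_le_sup => //; exact: Sa.
  by apply: ge_sup; [exists a; exact: Sa|move=> t [/andP[]]].
(* For [q] in [S tau'] just left of [tm tau'], the chord from [p] to [q] is at most tau' - tau;
   continuity of [gamma] at [tm tau'] lets [q] tend to [tm tau']. *)
have key p tau tau' : 0 <= tau' -> a <= p <= tm tau' ->
    (tau%:E <= curve_length a p gamma)%E -> tau <= tau' ->
    mdist (gamma p) (gamma (tm tau')) <= tau' - tau.
  move=> tau'0 /andP[ap ptm] taup tautau'.
  have [->|pneq] := eqVneq p (tm tau'); first by rewrite mdistxx subr_ge0.
  have {pneq}ptm : p < tm tau' by rewrite lt_neqAle pneq.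
  apply/ler_addgt0Pr => e e0.
  have [d d0 dP] := cts _ (tmab _ tau'0) _ e0.
  have m0 : 0 < Num.min d (tm tau' - p) by rewrite lt_min d0 subr_gt0.
  have [|q [/andP[aq qb] qtau'] qtm] := @sup_adherent _ (S tau') _ m0.
    by split => //; exists a; exact: Sa.
  have qle : q <= tm tau' by apply: ub_le_sup => //; split => //; apply/andP.
  move: qtm; rewrite -/(tm tau') ltrBlDr -ltrBlDl lt_min => /andP[qd qp].
  have {}qp : p < q by lra.
  have pq : mdist (gamma p) (gamma q) <= tau' - tau.
    rewrite lerBrDl -lee_fin EFinD.
    apply: le_trans (le_trans (curve_lengthD_ge gamma a qp) qtau').
    exact: leeD2r.
  apply: le_trans (metric_triangle _ (gamma q) _) _; apply: lerD => //.
  rewrite metric_sym ltW//; apply: dP; first by rewrite aq.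
  by rewrite ger0_norm// subr_ge0.
have aab : a <= a <= b by rewrite lexx.
exists (gamma \o tm); split => /=.
- apply/esym/mdist_positivity/eqP; rewrite eq_le mdist_ge0 andbT.
  rewrite -[leRHS](subrr 0); apply: key => //; last by rewrite curve_length_refl.
  by rewrite lexx; case/andP: (tmab 0 (lexx _)).
- congr gamma; apply/eqP; rewrite eq_le; apply/andP; split.
    apply: ge_sup; last by move=> t [/andP[]].
    by exists b; split => //; rewrite ab lexx.
  by apply: ub_le_sup => //; split => //; rewrite ab lexx.
move=> t t' t0 tt'; have t'0 := le_trans t0 tt'.
have tmtm : tm t <= tm t'.
  apply: ge_sup; first by exists a; exact: Sa.
  move=> u [uab ut]; apply: ub_le_sup => //; split => //.
  by apply: le_trans ut _; rewrite lee_fin.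
have [->|tmneq] := eqVneq (tm t) (tm t'); first by rewrite mdistxx subr_ge0.
have {tmneq}tmlt : tm t < tm t' by rewrite lt_neqAle tmneq.
apply/ler_addgt0Pr => e e0.
have [d d0 dP] := cts _ (tmab _ t0) _ e0.
(* Right of the supremum [tm t] the length exceeds [t], so [key] applies to [p]; continuity at
   [tm t] covers the remaining gap. *)
pose p := tm t + Num.min d (tm t' - tm t) / 2.
have m0 : 0 < Num.min d (tm t' - tm t) by rewrite lt_min d0 subr_gt0.
have md : Num.min d (tm t' - tm t) <= d by rewrite ge_min lexx.
have mt : Num.min d (tm t' - tm t) <= tm t' - tm t by rewrite ge_min lexx orbT.
have /andP[atm tmb] := tmab _ t0; have /andP[atm' tm'b] := tmab _ t'0.
have pab : a <= p <= b by rewrite /p; lra.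
apply: le_trans (metric_triangle _ (gamma p) _) _; rewrite addrC; apply: lerD.
  apply: key => //; first by rewrite /p; lra.
  rewrite leNgt; apply/negP => pt.
  have : p <= tm t by apply: ub_le_sup => //; split => //; exact: ltW.
  by rewrite /p; lra.
rewrite ltW//; apply: dP => //; rewrite /p opprD addNKr normrN gtr0_norm; lra.
Qed.

(** Arc length run at constant speed L / s with L = lambda d(y1, y2), so that time [s] corresponds
    to arc length L. *)
Lemma quasiconvex_lipschitz_path (R : realType) (Y : metricType R)
    (lambda : R) :
  0 <= lambda -> quasiconvex Y lambda -> forall (y1 y2 : Y) (s : R), 0 < s ->
  exists sigma : R -> Y, [/\ sigma 0 = y1, sigma s = y2 &
    forall t t', 0 <= t -> t <= t' ->
      mdist (sigma t) (sigma t') <= lambda * mdist y1 y2 / s * (t' - t)].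
Proof.
move=> l0 qc y1 y2 s s0; have [a [b [gamma [ab cts ga gb len]]]] := qc y1 y2.
have [sigma [s1 s2 slip]] := curve_reparametrization ab cts len.
set L := lambda * mdist y1 y2 in s2 *.
have L0 : 0 <= L / s by rewrite divr_ge0 ?mulr_ge0 ?mdist_ge0// ltW.
exists (fun t => sigma (L / s * t)); split; first by rewrite mulr0 s1.
  by rewrite divfK ?gt_eqF// s2.
move=> t t' t0 tt'; rewrite mulrBr; apply: slip; first exact: mulr_ge0.
exact: ler_wpM2l.
Qed.

(** * Chain classes *)

(* The points joined to x by a finite chain with steps < s, defined
   impredicatively. *)
Definition chain_class (R : realType) (T : metricType R) (s : R) (x : T) :
    set T :=
  [set y | forall P : set T,
    (forall u v, mdist u v < s -> P u -> P v) -> P x -> P y].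

Section chain_class.
Context {R : realType} {T : metricType R}.
Implicit Types (x y z : T) (s : R).

Lemma chain_class_refl s x : chain_class s x x.
Proof. by move=> P _. Qed.

Lemma chain_class_step s x y : mdist x y < s -> chain_class s x y.
Proof. by move=> xy P; apply. Qed.

Lemma chain_class_eq s x y :
  chain_class s x y -> chain_class s x = chain_class s y.
Proof.
move=> xy; apply/seteqP; split => z xz P Pcl.
  move=> Py; apply: (xz P) => //.
  (* This reverses the chain: the metric being symmetric, [P w -> P x] is also stable under short
     steps. *)
  apply: (xy (fun w => P w -> P x)) => // u v uv Pu Pv; apply: Pu.
  by apply: Pcl Pv; rewrite metric_sym.
by move=> Px; apply: (xz P) => //; apply: (xy P).
Qed.

Lemma chain_class_sub s s' x : s <= s' -> chain_class s x `<=` chain_class s' x.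
Proof.
move=> ss' y xy P Pcl; apply: xy => u v uv; apply: Pcl.
exact: lt_le_trans ss'.
Qed.

(** A step shorter than [s] cannot leave a member of the cover at scale [s], so a chain class stays
    inside one member. *)
Lemma nagata_chain_class c s x y : nagata_dim0 T c -> 0 < s ->
  chain_class s x y -> mdist x y <= c * s.
Proof.
move=> nag s0; have [Bs [cov dia sep]] := nag s s0.
have /= := I; rewrite -[True]/([set: T] x) -cov => -[B BsB Bx] xy.
have By : B y.
  apply: xy Bx => u v uv Bu; have /= := I.
  rewrite -[True]/([set: T] v) -cov => -[B' BsB' B'v].
  have [->//|BB'] := pselect (B = B').
  have := sep _ _ BsB BsB' BB'; rewrite ltNge => /negP; case.
  apply: (@le_trans _ _ (mdist u v)%:E); last by rewrite lee_fin ltW.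
  by apply: ereal_inf_lbound; exists (u, v).
rewrite -lee_fin; apply: le_trans (dia _ BsB).
by apply: ereal_sup_ubound; exists (x, y).
Qed.

End chain_class.

(** * Dyadic heights *)

Section dyadic.
Context {R : realType}.
Implicit Types (h : R) (k : int).

Definition dyadic_level h : int := Num.floor (ln h / ln 2).

Lemma exp2zD1 k : 2 ^ (k + 1) = 2 * 2 ^ k :> R.
Proof. by rewrite exprzDr ?unitfE// mulrC. Qed.

Lemma dyadic_levelP h : 0 < h ->
  2 ^ dyadic_level h <= h < 2 ^ (dyadic_level h + 1).
Proof.
move=> h0; have ln20 : 0 < ln (2 : R) by rewrite ln_gt0 ?ltr1n.
have /andP[l1 l2] := floor_itv (ln h / ln 2).
rewrite -!powR_intmul// /powR pnatr_eq0/= -[X in _ <= X < _]lnK ?posrE//.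
by rewrite ler_expR ltr_expR -ler_pdivlMr// -ltr_pdivrMr// l1.
Qed.

Lemma dyadic_level_eq k h : 2 ^ k <= h -> h < 2 ^ (k + 1) -> dyadic_level h = k.
Proof.
move=> kh hk; have h0 : 0 < h by apply: lt_le_trans kh; exact: exprz_gt0.
have /andP[l1 l2] := dyadic_levelP h0.
have := le_lt_trans kh l2; have := le_lt_trans l1 hk.
rewrite !ltr_eXz2l ?ltr1n// !ltzD1 => ? ?.
by apply/eqP; rewrite eq_le; apply/andP.
Qed.

(** The bounds add up when [h, h'] is cut at the powers of 2 inside it. *)
Lemma dyadic_lipschitz (T : metricType R) (g : R -> T) (M : R) :
  (forall k h h', 2 ^ k <= h -> h <= h' -> h' <= 2 ^ (k + 1) ->
    mdist (g h) (g h') <= M * (h' - h)) ->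
  forall h h', 0 < h -> h <= h' -> mdist (g h) (g h') <= M * (h' - h).
Proof.
move=> gM h h' h0 hh'.
have /andP[+ _] := dyadic_levelP h0; move: (dyadic_level h) => k kh.
have /andP[_ +] := dyadic_levelP (lt_le_trans h0 hh').
move: (dyadic_level h') => k' hk'.
have {}hk' : h' <= 2 ^ (k + (absz (k' + 1 - k)%R)).
  apply: le_trans (ltW hk') _; rewrite ler_eXz2l ?ltr1n// -lerBlDl abszE.
  exact: ler_norm.
elim: (absz _) h h' {h0} kh hh' hk' => [|n IH] h h' kh hh' hk'.
  have -> : h' = h by apply/eqP; rewrite eq_le hh' (le_trans hk') ?addr0.
  by rewrite mdistxx subrr mulr0.
rewrite -(addn1 n) PoszD addrA in hk'.
have [h'm|/ltW mh'] := leP h' (2 ^ (k + n)); first exact: IH.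
have [mh|/ltW hm] := leP (2 ^ (k + n)) h; first exact: gM mh hh' hk'.
apply: le_trans (metric_triangle _ (g (2 ^ (k + n))) _) _.
rewrite -[h' - h](subrKA (2 ^ (k + n))) addrC mulrDr.
by apply: lerD; [exact: (gM (k + n))|exact: IH].
Qed.

End dyadic.

(** * The map on the tree *)

(* G z h is the value at the point of the tree at height h / 2 above the leaf z:
   leaves z and z' have merged there iff a chain with steps < 2 ^ (k + 1) joins
   them, where 2 ^ k <= h < 2 ^ (k + 1). *)
Lemma tree_extension (R : realType) (T Y : metricType R) (c lambda : R)
    (f : T -> Y) (z0 : T) : 0 <= c -> 1 <= lambda ->
  nagata_dim0 T c -> quasiconvex Y lambda -> mlipschitz 1 f ->
  exists G : T -> R -> Y, [/\ forall z, G z 0 = f z,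
    forall z h h', 0 <= h -> h <= h' ->
      mdist (G z h) (G z h') <= 4 * c * lambda * (h' - h) &
    forall z z' k h, chain_class (2 ^ (k + 1)) z z' -> 2 ^ k <= h ->
      h < 2 ^ (k + 1) -> G z h = G z' h].
Proof.
move=> c0 l1 nag qc flip; have l0 : 0 <= lambda by lra.
have p20 (k : int) : 0 < 2 ^ k :> R by exact: exprz_gt0.
(* One curve is fixed per triple, so an edge depends only on its end values and its length; for s <=
   0 the curve is a dummy. *)
have /choice[sg sgP] : forall q : Y * Y * R, exists sigma : R -> Y, 0 < q.2 ->
    [/\ sigma 0 = q.1.1, sigma q.2 = q.1.2 & forall t t', 0 <= t -> t <= t' ->
      mdist (sigma t) (sigma t')
        <= lambda * mdist q.1.1 q.1.2 / q.2 * (t' - t)].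
  move=> [[y1 y2] s] /=; have [s0|_] := ltP 0 s; last by exists (fun=> y1).
  by have [sigma sP] := quasiconvex_lipschitz_path l0 qc y1 y2 s0; exists sigma.
(* Picking from the class as a set makes the representative common to all its points. *)
pose b (z : T) (k : int) := xget z0 (chain_class (2 ^ k) z).
have bP z k : chain_class (2 ^ k) z (b z k).
  by apply: xgetPex; exists z; exact: chain_class_refl.
have bE z z' k : chain_class (2 ^ k) z z' -> b z k = b z' k.
  by move=> /chain_class_eq E; rewrite /b E.
have fb z k : mdist (f z) (f (b z k)) <= c * 2 ^ k.
  by apply: le_trans (flip _ _) _; rewrite mul1r; exact: nagata_chain_class.
(* Both representatives lie in the class of [z] at scale 2 ^ (k + 2), of diameter at most c 2 ^ (k +
   2): hence the factor 4. *)
have fbb z k : mdist (f (b z (k + 1))) (f (b z (k + 1 + 1))) <= 4 * c * 2 ^ k.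
  apply: le_trans (flip _ _) _; rewrite mul1r.
  have -> : 4 * c * 2 ^ k = c * 2 ^ (k + 1 + 1) by rewrite !exp2zD1; lra.
  have le12 : 2 ^ (k + 1) <= 2 ^ (k + 1 + 1) :> R.
    by rewrite ler_eXz2l ?ltr1n ?lerDl.
  apply: nagata_chain_class => //.
  by rewrite -(chain_class_eq (chain_class_sub le12 (bP z (k + 1)))).
(* The edge over heights from 2 ^ k to 2 ^ (k + 1) uses levels k + 1 and k + 2; by this shift it is
   shared by all points less than 2 ^ (k + 1) apart. *)
pose edge z k := sg (f (b z (k + 1)), f (b z (k + 1 + 1)), 2 ^ k).
have edgeP z k : [/\ edge z k 0 = f (b z (k + 1)),
    edge z k (2 ^ k) = f (b z (k + 1 + 1)) &
    forall t t', 0 <= t -> t <= t' ->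
      mdist (edge z k t) (edge z k t') <= 4 * c * lambda * (t' - t)].
  have /= [e1 e2 e3] :=
    sgP (f (b z (k + 1)), f (b z (k + 1 + 1)), 2 ^ k) (p20 k).
  split=> // t t' t0 tt'; apply: le_trans (e3 _ _ t0 tt') _.
  apply: ler_wpM2r; rewrite ?subr_ge0// ler_pdivrMr//.
  by have := ler_wpM2l l0 (fbb z k); lra.
have edgeE z z' k : chain_class (2 ^ (k + 1)) z z' -> edge z k = edge z' k.
  move=> zz'; rewrite /edge; congr (sg (f _, f _, _)); apply: bE => //.
  by apply: chain_class_sub zz'; rewrite ler_eXz2l ?ltr1n// lerDl.
pose G z h :=
  if h <= 0 then f z else edge z (dyadic_level h) (h - 2 ^ dyadic_level h).
have GE z k h : 2 ^ k <= h -> h < 2 ^ (k + 1) -> G z h = edge z k (h - 2 ^ k).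
  move=> kh hk; rewrite /G leNgt (lt_le_trans (p20 k) kh)/=.
  by rewrite (dyadic_level_eq kh hk).
have G0 z : G z 0 = f z by rewrite /G lexx.
clearbody b edge G.
(* The formula extends to the right end because edge [k] ends where edge [k + 1] starts. *)
have Gedge z k h : 2 ^ k <= h -> h <= 2 ^ (k + 1) ->
    G z h = edge z k (h - 2 ^ k).
  move=> kh; rewrite le_eqVlt => /orP[/eqP ->|]; last exact: GE.
  rewrite (GE z (k + 1))//; last first.
    by rewrite [ltRHS]exp2zD1; have := p20 (k + 1); lra.
  rewrite subrr; have [-> _ _] := edgeP z (k + 1); have [_ <- _] := edgeP z k.
  by congr edge; rewrite exp2zD1; lra.
have Gpos z h h' : 0 < h -> h <= h' ->
    mdist (G z h) (G z h') <= 4 * c * lambda * (h' - h).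
  apply: dyadic_lipschitz => {h h'} k h h' kh hh' hk.
  rewrite (Gedge z k h)//; last exact: le_trans hk.
  rewrite (Gedge z k h')//; last exact: le_trans hh'.
  have [_ _] := edgeP z k => /(_ (h - 2 ^ k) (h' - 2 ^ k)).
  by rewrite subr_ge0 lerB// opprB addrA subrK; exact.
exists G; split=> [z|z h h' h0 hh'|z z' k h zz' kh hk]; first exact: G0.
- have [hgt0|hle0] := ltP 0 h; first exact: Gpos.
  have {h h0 hle0 hh'}[-> h'0] : h = 0 /\ 0 <= h'.
    by split; [apply/eqP; rewrite eq_le h0 hle0|exact: le_trans hh'].
  rewrite G0; have [->|h'n] := eqVneq h' 0.
    by rewrite G0 mdistxx subrr mulr0.
  have {h'n}h'0 : 0 < h' by rewrite lt_neqAle eq_sym h'n.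
  have /andP[+ _] := dyadic_levelP h'0; move: (dyadic_level h') => k kh.
  (* The value at height 2 ^ k is [f (b z (k + 1))], within c 2 ^ (k + 1) of the leaf value
     [f z]. *)
  apply: le_trans (metric_triangle _ (G z (2 ^ k)) _) _.
  have := Gpos z _ _ (p20 k) kh.
  rewrite (GE z k (2 ^ k))//; last by rewrite exp2zD1; have := p20 k; lra.
  rewrite subrr; have [-> _ _] := edgeP z k.
  have := fb z (k + 1); rewrite exp2zD1.
  have : c * 2 ^ k <= lambda * (c * 2 ^ k).
    by rewrite ler_peMl// mulr_ge0// ltW.
  have : 0 <= c * 2 ^ k by rewrite mulr_ge0// ltW.
  move: (mdist _ _) (mdist _ _) (2 ^ k) => d1 d2 t; lra.
- by rewrite !(GE _ k)// (edgeE _ _ _ zz').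
Qed.

(** * The extension to X *)

Theorem corollary1p4 (R : realType) (X Y : metricType R) (Z : set X)
    (c lambda : R) :
  complete_space X -> complete_space Y -> [set: Y] !=set0 ->
  closed Z -> 0 <= c -> nagata_dim0 (set_type Z) c ->
  1 <= lambda -> quasiconvex Y lambda ->
  forall f : set_type Z -> Y, mlipschitz 1 f ->
  exists fbar : X -> Y,
    mlipschitz (8 * c * lambda) fbar /\
    (forall z : set_type Z, fbar (\val z) = f z).
Proof.
move=> _ _ [y0 _] Zcl c0 nag l1 qc f flip; have l0 : 0 <= lambda by lra.
have cl0 : 0 <= c * lambda by exact: mulr_ge0.
have [[z0 _]|Z0] := pselect (exists z : set_type Z, True); last first.
  exists (fun=> y0); split=> [x y|z]; last by case: Z0; exists z.
  by rewrite mdistxx -!mulrA !mulr_ge0// mdist_ge0.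
have [G [G0 Glip Gchain]] := tree_extension z0 c0 l1 nag qc flip.
have Geq (z z' : set_type Z) h : 0 <= h -> mdist (\val z) (\val z') <= h ->
    G z h = G z' h.
  rewrite le_eqVlt => /orP[/eqP<-|h0] zz'.
    congr G; apply: mdist_positivity; apply/eqP.
    by rewrite eq_le mdist_ge0 andbT.
  have /andP[kh hk] := dyadic_levelP h0.
  apply: (Gchain _ _ (dyadic_level h)) => //; apply: chain_class_step.
  exact: le_lt_trans hk.
pose D x := inf [set mdist x (\val z) | z in [set: set_type Z]].
have Dhas x : has_inf [set mdist x (\val z) | z in [set: set_type Z]].
  split; first by exists (mdist x (\val z0)), z0.
  by exists 0 => _ [z _ <-]; exact: mdist_ge0.
have Dle x (z : set_type Z) : D x <= mdist x (\val z).
  by apply: ge_inf; [case: (Dhas x)|exists z].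
have D0 x : 0 <= D x.
  by apply: lb_le_inf; [case: (Dhas x)|move=> _ [z _ <-]; exact: mdist_ge0].
have Dadh x e : 0 < e -> exists z : set_type Z, mdist x (\val z) < D x + e.
  by move=> e0; have [_ [z _ <-] ?] := inf_adherent e0 (Dhas x); exists z.
have Dlip x x' : D x <= mdist x x' + D x'.
  apply/ler_addgt0Pr => e e0; have [z zP] := Dadh x' e e0.
  have := Dle x z; have := metric_triangle x x' (\val z); lra.
have Z_D x : D x = 0 -> exists z : set_type Z, \val z = x.
  move=> Dx0; suff Zx : Z x by exists (SigSub (mem_set Zx)).
  apply: Zcl => U /nbhs_ballP[e e0 eU]; have [z zP] := Dadh x e e0.
  exists (\val z); split; first exact: set_valP.
  by apply: eU; rewrite ballEmdist /= -[e]add0r -Dx0.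
(* The value [y] is fixed before [e], so that [e] may later depend on a pair of points. *)
have /choice[F FP] : forall x, exists y, forall e, 0 < e ->
    exists z : set_type Z, mdist x (\val z) <= D x + e /\ y = G z (2 * D x).
  move=> x; have [/Z_D[z zx]|Dn0] := eqVneq (D x) 0.
    exists (G z (2 * D x)) => e e0; exists z; split => //.
    by rewrite zx mdistxx addr_ge0// ltW.
  have {}Dn0 : 0 < 2 * D x by rewrite mulr_gt0// lt_neqAle eq_sym Dn0 D0.
  have /andP[] := dyadic_levelP Dn0; move: (dyadic_level _) => k kD Dk.
  (* Two points of [Z] at distance less than 2 ^ k from [x] are less than 2 ^ (k + 1) apart, hence
     in one chain class. *)
  have Dk2 : 0 < 2 ^ k - D x by rewrite exp2zD1 in Dk; lra.
  have [z1 z1P] := Dadh x _ Dk2; exists (G z1 (2 * D x)) => e e0.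
  have : 0 < Num.min e (2 ^ k - D x) by rewrite lt_min e0.
  move=> /(Dadh x)[z]; rewrite -ltrBlDl lt_min => /andP[ze zk].
  exists z; split; first by lra.
  apply: (Gchain _ _ k) => //; apply: chain_class_step; rewrite exp2zD1.
  have := metric_triangle (\val z1) x (\val z); rewrite [mdist _ x]metric_sym.
  by rewrite -[mdist z1 z]/(mdist (\val z1) (\val z)); lra.
exists F; split=> [x x'|z]; last first.
  apply/esym/mdist_positivity/eqP; rewrite eq_le mdist_ge0 andbT.
  apply/ler_addgt0Pr => e e0; rewrite add0r.
  have Dz : D (\val z) = 0.
    by apply/eqP; rewrite eq_le D0 andbT -(mdistxx (\val z)) Dle.
  have [z' [zz' ->]] := FP (\val z) e e0.
  move: zz'; rewrite Dz mulr0 add0r G0 => zz'.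
  by apply: le_trans (flip _ _) _; rewrite mul1r.
apply/ler_addgt0Pr => e e0; set M := 8 * c * lambda.
have M0 : 0 <= M by rewrite /M; lra.
(* This choice gives M (2 e') <= e; the added 1 keeps the denominator positive when [M] is 0. *)
have e'0 : 0 < e / (2 * (M + 1)) by rewrite divr_gt0// mulr_gt0//; lra.
set e' := e / _ in e'0.
have [z [xz ->]] := FP x e' e'0; have [z' [xz' ->]] := FP x' e' e'0.
(* the height (doubled) at which the upward paths from both images have met *)
pose m := mdist x x' + D x + D x' + 2 * e'.
have zz'm : mdist (\val z) (\val z') <= m.
  have := metric_triangle (\val z) x (\val z').
  have := metric_triangle x x' (\val z').
  by rewrite [mdist (\val z) x]metric_sym /m; lra.
have m0 : 0 <= m by apply: le_trans zz'm; exact: mdist_ge0.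
have xx'0 := mdist_ge0 x x'.
have hm : 2 * D x <= m by have := Dlip x x'; rewrite /m; lra.
have h'm : 2 * D x' <= m.
  by have := Dlip x' x; rewrite metric_sym /m; lra.
(* Up to [m] along the path of [z], then down along that of [z']: the heights climbed add up to 2
   (d(x, x') + 2 e'), which turns 4 c lambda into 8 c lambda. *)
apply: le_trans (metric_triangle _ (G z m) _) _.
rewrite {2}(Geq _ _ _ m0 zz'm) [X in _ + X]metric_sym.
apply: le_trans (lerD (Glip _ _ _ _ hm) (Glip _ _ _ _ h'm)) _;
  rewrite ?mulr_ge0//.
rewrite -mulrDr (_ : _ + _ = 2 * (mdist x x' + 2 * e')); last by rewrite /m; lra.
have -> : 4 * c * lambda * (2 * (mdist x x' + 2 * e')) =
    M * mdist x x' + M * (2 * e').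
  by rewrite /M; lra.
have e'E : e' * (2 * (M + 1)) = e by rewrite divfK// gt_eqF// mulr_gt0//; lra.
by rewrite lerD2l -[leRHS]e'E; clearbody M e'; lra.
Qed.
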